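(* Let $d,k\geq2$. Suppose that $g\in\mathrm{AAut}(\mathcal{T}_{d,k})$, that $K\leq\mathrm{AAut}(\mathcal{T}_{d,k})$ is a relatively compact subgroup, and that $\mathcal{P}$ is a regular partition admissible for $g$ and for every element of $K$. If $\langle K,g\rangle$ contains no translations, then there is a regular partition $\mathcal{Q}$ refining $\mathcal{P}$ such that $\langle K,g\rangle\leq\mathrm{Stab}(\mathcal{Q})$.
   Context: $\mathcal{T}_{d,k}$ is the rooted tree whose root $r$ has degree $k$ and all other vertices have degree $d+1$. Its boundary $\partial\mathcal{T}_{d,k}$ is the set of rays $(r=\xi_0,\xi_1,\dots)$ with $\xi_{n+1}$ a child of $\xi_n$; with $N(\xi,\xi')$ the largest $n$ such that $\xi_n=\xi'_n$, put $\mathrm{dist}(\xi,\xi')=d^{-N(\xi,\xi')}$. A homothety is a map multiplying all distances by a fixed positive constant. A regular partition is a partition of $\partial\mathcal{T}_{d,k}$ into finitely many proper metric balls; $\mathcal{Q}$ refines $\mathcal{P}$ if each part of $\mathcal{Q}$ is contained in a part of $\mathcal{P}$. A regular partition $\mathcal{P}$ is admissible for a homeomorphism $g$ of $\partial\mathcal{T}_{d,k}$ if $g|_B:B\to g(B)$ is a homothety for each $B\in\mathcal{P}$; an almost automorphism is a homeomorphism admitting an admissible regular partition. $\mathrm{AAut}(\mathcal{T}_{d,k})$ is the group of almost automorphisms with the locally compact group topology in which $\mathrm{Aut}(\mathcal{T}_{d,k})$ (the isometries of $\partial\mathcal{T}_{d,k}$) is a compact open subgroup. $\mathrm{Stab}(\mathcal{Q})$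 is the set of $h\in\mathrm{AAut}(\mathcal{T}_{d,k})$ such that $\mathcal{Q}$ is admissible for $h$ and $\{h(B):B\in\mathcal{Q}\}=\mathcal{Q}$. An element $h$ is a translation if there is a ball $B$ and $n\in\mathbb{Z}$ with $h^n|_B:B\to h^n(B)$ a homothety and $h^n(B)\subsetneq B$. *)

(* Defs.v *)
From Stdlib Require Import Reals List Classical ClassicalEpsilon
  FunctionalExtensionality PropExtensionality.
Open Scope R_scope.

(* A ray (r = xi_0, xi_1, ...) is encoded by the sequence of child choices:
   choice 0 in {0..k-1} (root has k children), choice n+1 in {0..d-1}
   (every other vertex has d children). xi_n is determined by the first n
   choices. *)
Definition ray (d k : nat) : Type :=
  { c : nat -> nat | forall n, (c n < match n with O => k | S _ => d end)%nat }.

Definition choice {d k : nat} (x : ray d k) : nat -> nat := proj1_sig x.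

(* xi_n = xi'_n : the first n choices agree *)
Definition agree {d k : nat} (n : nat) (x y : ray d k) : Prop :=
  forall i, (i < n)%nat -> choice x i = choice y i.

(* N(xi,xi') = largest n with xi_n = xi'_n (meaningful for xi <> xi') *)
Definition Nmax {d k : nat} (x y : ray d k) : nat :=
  epsilon (inhabits 0%nat) (fun n => agree n x y /\ ~ agree (S n) x y).

Definition dist {d k : nat} (x y : ray d k) : R :=
  if excluded_middle_informative (forall i, choice x i = choice y i)
  then 0 else / (INR d ^ Nmax x y).

Definition rset (d k : nat) := ray d k -> Prop.
Definition rmap (d k : nat) := ray d k -> ray d k.

Definition is_ball {d k : nat} (B : rset d k) : Prop :=
  exists (c : ray d k) (r : R), 0 < r /\ forall y, B y <-> dist c y <= r.

Definition is_proper_ball {d k : nat} (B : rset d k) : Prop :=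
  is_ball B /\ exists y, ~ B y.

Definition image {d k : nat} (g : rmap d k) (B : rset d k) : rset d k :=
  fun y => exists x, B x /\ y = g x.

Definition homothety_on {d k : nat} (g : rmap d k) (B : rset d k) : Prop :=
  exists lam : R, 0 < lam /\
    forall x y, B x -> B y -> dist (g x) (g y) = lam * dist x y.

Definition rpartition (d k : nat) := rset d k -> Prop.

Definition regular {d k : nat} (P : rpartition d k) : Prop :=
  (exists l : list (rset d k), forall B, P B <-> In B l) /\
  (forall B, P B -> is_proper_ball B) /\
  (forall x, exists B, P B /\ B x) /\
  (forall B B' x, P B -> P B' -> B x -> B' x -> B = B').

Definition refines {d k : nat} (Q P : rpartition d k) : Prop :=
  forall B, Q B -> exists B', P B' /\ forall x, B x -> B' x.

Definition admissible {d k : nat} (P : rpartition d k) (g : rmap d k) : Prop :=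
  forall B, P B -> homothety_on g B.

Definition continuous_map {d k : nat} (g : rmap d k) : Prop :=
  forall x eps, 0 < eps -> exists delta, 0 < delta /\
    forall y, dist x y < delta -> dist (g x) (g y) < eps.

Definition inverse_of {d k : nat} (g ginv : rmap d k) : Prop :=
  (forall x, g (ginv x) = x) /\ (forall x, ginv (g x) = x).

Definition homeomorphism {d k : nat} (g : rmap d k) : Prop :=
  continuous_map g /\ exists ginv, inverse_of g ginv /\ continuous_map ginv.

Definition aaut {d k : nat} (g : rmap d k) : Prop :=
  homeomorphism g /\ exists P, regular P /\ admissible P g.

(* Aut(T_{d,k}) = isometries of the boundary onto itself *)
Definition isometry {d k : nat} (b : rmap d k) : Prop :=
  (forall x y, dist (b x) (b y) = dist x y) /\ (forall y, exists x, b x = y).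

Definition compose {d k : nat} (f g : rmap d k) : rmap d k := fun x => f (g x).

(* The group topology in which Aut is a compact open subgroup: a
   neighbourhood base at g is given by the left translates g.U_eps, where
   U_eps = {b in Aut | sup_xi dist(b xi, xi) < eps} is a neighbourhood
   base of the identity in Aut (topology of uniform convergence). *)
Definition aopen {d k : nat} (W : rmap d k -> Prop) : Prop :=
  forall g, W g -> aaut g /\ exists eps, 0 < eps /\
    forall b, isometry b -> (forall x, dist (b x) x < eps) -> W (compose g b).

Definition aclosure {d k : nat} (S : rmap d k -> Prop) : rmap d k -> Prop :=
  fun g => aaut g /\ forall W, aopen W -> W g -> exists h, S h /\ W h.

Definition acompact {d k : nat} (C : rmap d k -> Prop) : Prop :=
  (forall g, C g -> aaut g) /\
  forall (I : Type) (U : I -> rmap d k -> Prop),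
    (forall i, aopen (U i)) -> (forall g, C g -> exists i, U i g) ->
    exists l : list I, forall g, C g -> exists i, In i l /\ U i g.

Definition rel_compact {d k : nat} (S : rmap d k -> Prop) : Prop :=
  acompact (aclosure S).

Definition subgroup {d k : nat} (K : rmap d k -> Prop) : Prop :=
  (forall h, K h -> aaut h) /\ K (fun x => x) /\
  (forall a b, K a -> K b -> K (compose a b)) /\
  (forall a b, K a -> inverse_of a b -> K b).

Inductive gen {d k : nat} (K : rmap d k -> Prop) (g : rmap d k)
  : rmap d k -> Prop :=
| gen_K : forall h, K h -> gen K g h
| gen_g : gen K g g
| gen_id : gen K g (fun x => x)
| gen_comp : forall a b, gen K g a -> gen K g b -> gen K g (compose a b)
| gen_inv : forall a b, gen K g a -> inverse_of a b -> gen K g b.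

Definition zpow {d k : nat} (h hinv : rmap d k) (n : Z) : rmap d k :=
  match n with
  | Z0 => fun x => x
  | Zpos p => fun x => Nat.iter (Pos.to_nat p) h x
  | Zneg p => fun x => Nat.iter (Pos.to_nat p) hinv x
  end.

Definition translation {d k : nat} (h : rmap d k) : Prop :=
  exists hinv, inverse_of h hinv /\
  exists (B : rset d k) (n : Z), is_ball B /\
    homothety_on (zpow h hinv n) B /\
    (forall y, image (zpow h hinv n) B y -> B y) /\
    (exists y, B y /\ ~ image (zpow h hinv n) B y).

Definition Stab {d k : nat} (Q : rpartition d k) (h : rmap d k) : Prop :=
  aaut h /\ admissible Q h /\
  (forall B, Q B -> Q (image h B)) /\
  (forall B', Q B' -> exists B, Q B /\ B' = image h B).

(* Main.v *)
(** Choose [L] such that every element of [K], [g] and [g^-1] maps each ball of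
    level at least [L] homothetically onto a ball.  Fix a ray [x] and let [N] be
    the (finite) number of balls of level less than [L].  If each of the balls of
    levels [0, ..., N] around [x] were mapped homothetically onto some ball of level
    less than [L] by an element of [<K,g>], two of them would have the same image,
    and the quotient of the two elements would map the larger one onto the smaller
    one: a translation.  Hence some ball around [x] of level at most [N] can only be
    moved to balls of level at least [L], so every word in the generators acts on it
    homothetically, letter by letter.  The maximal balls with this property form the
    required invariant partition. *)

From Stdlib Require Import Reals List Lra Lia Classical ClassicalEpsilon
  FunctionalExtensionality PropExtensionality FinFun Arith.
Require Import Defs.

(** * Finite lists *)

(** A choice of witnesses for the [length l + 1] indices cannot be injective into [l]. It serves to
    find two concentric balls with the same image. *)
Lemma pigeonhole_rel (A : Type) (R : nat -> A -> Prop) (l : list A) :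
  (forall n, (n <= length l)%nat -> exists a, In a l /\ R n a) ->
  exists i j a, (i < j <= length l)%nat /\ R i a /\ R j a.
Proof.
  intros H.
  (* The bound on [n] moves under the existential so that a total choice function exists; past the
     bound the witness for index 0 is a dummy value. *)
  assert (Hc : forall n, exists a, (n <= length l)%nat -> In a l /\ R n a).
  { intros n. destruct (le_dec n (length l)) as [Hn|Hn].
    - destruct (H n Hn) as [a Ha]. now exists a.
    - destruct (H 0%nat (Nat.le_0_l _)) as [a _]. exists a. lia. }
  set (f := fun n => proj1_sig (constructive_indefinite_description _ (Hc n))).
  assert (Hf : forall n, (n <= length l)%nat -> In (f n) l /\ R n (f n)).
  { intros n. exact (proj2_sig (constructive_indefinite_description _ (Hc n))). }
  apply NNPP. intros Hno.
  assert (Hnd : NoDup (map f (seq 0 (S (length l))))).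
  { apply NoDup_map_NoDup_ForallPairs; [|apply seq_NoDup].
    intros i j Hi Hj Hij. apply in_seq in Hi, Hj.
    destruct (Nat.lt_trichotomy i j) as [Hlt|[He|Hlt]]; [|exact He|]; exfalso; apply Hno.
    - exists i, j, (f i). repeat split; try lia; [apply Hf; lia|rewrite Hij; apply Hf; lia].
    - exists j, i, (f i). repeat split; try lia; [rewrite Hij; apply Hf; lia|apply Hf; lia]. }
  apply (NoDup_incl_length (l' := l)) in Hnd.
  - rewrite length_map, length_seq in Hnd. lia.
  - intros a Ha. apply in_map_iff in Ha. destruct Ha as [n [<- Hn]].
    apply in_seq in Hn. apply Hf. lia.
Qed.

Lemma list_uniform_bound (A : Type) (R : A -> nat -> Prop) (l : list A) :
  (forall a, In a l -> exists n, R a n) ->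
  exists N, forall a, In a l -> exists n, (n <= N)%nat /\ R a n.
Proof.
  induction l as [|a l IH]; intros H.
  - exists 0%nat. intros a [].
  - destruct IH as [N HN]; [intros b Hb; apply H; now right|].
    destruct (H a (or_introl eq_refl)) as [n Hn].
    exists (Nat.max n N). intros b [<-|Hb].
    + exists n. split; [lia|exact Hn].
    + destruct (HN b Hb) as [m [Hm Hr]]. exists m. split; [lia|exact Hr].
Qed.

Lemma list_restrict (A : Type) (S : A -> Prop) (l : list A) :
  (forall a, S a -> In a l) -> exists l', forall a, S a <-> In a l'.
Proof.
  intros H.
  exists (filter (fun a => if excluded_middle_informative (S a) then true else false) l).
  intros a. rewrite filter_In. destruct (excluded_middle_informative (S a)) as [Ha|Ha].
  - split; auto.
  - split; [tauto|intros [_ ?]; discriminate].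
Qed.

(** * Cylinders *)

Lemma rset_ext (d k : nat) (A B : rset d k) : (forall x, A x <-> B x) -> A = B.
Proof.
  intros H. apply functional_extensionality. intros x.
  apply propositional_extensionality, H.
Qed.

Lemma agree_refl (d k n : nat) (x : ray d k) : agree n x x.
Proof. now intros i _. Qed.

Lemma agree_sym (d k n : nat) (x y : ray d k) : agree n x y -> agree n y x.
Proof. intros H i Hi. symmetry. now apply H. Qed.

Lemma agree_trans (d k n : nat) (x y z : ray d k) :
  agree n x y -> agree n y z -> agree n x z.
Proof. intros H1 H2 i Hi. rewrite H1 by exact Hi. now apply H2. Qed.

Lemma agree_le (d k m n : nat) (x y : ray d k) :
  (m <= n)%nat -> agree n x y -> agree m x y.
Proof. intros Hmn H i Hi. apply H. lia. Qed.

Lemma agree_S (d k n : nat) (x y : ray d k) :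
  agree (S n) x y <-> agree n x y /\ choice x n = choice y n.
Proof.
  split.
  - intros H. split; [apply agree_le with (S n); auto|apply H; lia].
  - intros [H He] i Hi. destruct (Nat.eq_dec i n) as [->|]; [exact He|apply H; lia].
Qed.

Lemma ray_with_choice (d k : nat) (x : ray d k) (n v : nat) :
  (v < match n with O => k | S _ => d end)%nat ->
  exists y, agree n x y /\ choice y n = v.
Proof.
  intros Hv.
  assert (Hc : forall i, ((if Nat.eq_dec i n then v else choice x i)
                          < match i with O => k | S _ => d end)%nat).
  { intros i. destruct (Nat.eq_dec i n) as [->|_]; [exact Hv|apply (proj2_sig x)]. }
  exists (exist _ (fun i => if Nat.eq_dec i n then v else choice x i) Hc).
  split.
  - intros i Hi. unfold choice at 2. simpl. destruct (Nat.eq_dec i n); [lia|reflexivity].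
  - unfold choice at 1. simpl. destruct (Nat.eq_dec n n); [reflexivity|lia].
Qed.

Lemma ray_splitting_off (d k : nat) (hd : (2 <= d)%nat) (hk : (2 <= k)%nat)
  (x : ray d k) (n : nat) : exists y, agree n x y /\ ~ agree (S n) x y.
Proof.
  assert (Hv : exists v, (v < match n with O => k | S _ => d end)%nat /\ v <> choice x n).
  { destruct (Nat.eq_dec (choice x n) 0) as [H0|H0].
    - exists 1%nat. split; [destruct n; lia|lia].
    - exists 0%nat. split; [destruct n; lia|lia]. }
  destruct Hv as [v [Hv Hne]]. destruct (ray_with_choice d k x n v Hv) as [y [Hy Hyn]].
  exists y. split; [exact Hy|]. rewrite agree_S. intros [_ He]. congruence.
Qed.

(** The ends below the [n]-th vertex of [x]. By [cyl_is_ball] and [ball_is_cyl] these are exactly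
    the metric balls. *)
Definition cyl {d k : nat} (n : nat) (x : ray d k) : rset d k := fun y => agree n x y.

Lemma cyl_le (d k m n : nat) (x y : ray d k) : (m <= n)%nat -> cyl n x y -> cyl m x y.
Proof. apply agree_le. Qed.

Lemma cyl_center (d k n : nat) (x y : ray d k) : cyl n x y -> cyl n x = cyl n y.
Proof.
  intros H. apply rset_ext. intros z. split; intros Hz.
  - apply agree_trans with x; [apply agree_sym, H|exact Hz].
  - apply agree_trans with y; [exact H|exact Hz].
Qed.

Lemma cyls_of_level (d k n : nat) :
  exists l : list (rset d k), forall x, In (cyl n x) l.
Proof.
  induction n as [|n [l Hl]].
  - exists ((fun _ => True) :: nil). intros x. left. apply rset_ext. intros y.
    split; auto. intros _ i Hi. lia.
  (* Every choice is below [d + k], at the root and elsewhere; a value that labels no child only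
     adds an empty set to the list. *)
  - exists (flat_map (fun B : rset d k => map (fun j y => B y /\ choice y n = j)
                       (seq 0 (d + k))) l).
    intros x. apply in_flat_map. exists (cyl n x). split; [apply Hl|].
    apply in_map_iff. exists (choice x n). split.
    + apply rset_ext. intros y. unfold cyl. rewrite agree_S.
      split; intros [H1 H2]; split; auto.
    + apply in_seq. pose proof (proj2_sig x n) as H. unfold choice.
      destruct n; lia.
Qed.

Lemma cyls_below_level (d k L : nat) :
  exists l : list (rset d k), forall n x, (n < L)%nat -> In (cyl n x) l.
Proof.
  induction L as [|L [l Hl]].
  - exists nil. intros; lia.
  - destruct (cyls_of_level d k L) as [l' Hl']. exists (l' ++ l). intros n x Hn.
    apply in_app_iff. destruct (Nat.eq_dec n L) as [->|]; [left; apply Hl'|].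
    right. apply Hl. lia.
Qed.

(** * Distances and balls *)

Lemma pow_INR_pos (d n : nat) : (2 <= d)%nat -> 0 < INR d ^ n.
Proof. intros hd. apply pow_lt, lt_0_INR. lia. Qed.

Lemma inv_pow_INR_le (d m n : nat) :
  (2 <= d)%nat -> (/ INR d ^ n <= / INR d ^ m <-> (m <= n)%nat).
Proof.
  intros hd. pose proof (pow_INR_pos d n hd). pose proof (pow_INR_pos d m hd).
  assert (1 < INR d) by (apply lt_1_INR; lia).
  split; intros Hle.
  - destruct (le_dec m n) as [|Hn]; [assumption|exfalso].
    assert (INR d ^ n < INR d ^ m) by (apply Rlt_pow; [assumption|lia]).
    assert (/ INR d ^ m < / INR d ^ n) by (apply Rinv_lt_contravar; [nra|assumption]).
    lra.
  - apply Rinv_le_contravar; [assumption|]. apply Rle_pow; [lra|assumption].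
Qed.

Lemma inv_pow_INR_small (d : nat) (r : R) :
  (2 <= d)%nat -> 0 < r -> exists n, / INR d ^ n < r.
Proof.
  intros hd Hr. assert (1 < INR d) by (apply lt_1_INR; lia).
  destruct (pow_lt_1_zero (/ INR d)) with (y := r) as [n Hn]; [|exact Hr|].
  - rewrite Rabs_pos_eq by (left; apply Rinv_0_lt_compat; lra).
    rewrite <- Rinv_1. apply Rinv_lt_contravar; lra.
  - exists n. specialize (Hn n (le_n n)). rewrite pow_inv in Hn.
    apply Rle_lt_trans with (2 := Hn). apply RRle_abs.
Qed.

(** If no level were the last one of agreement, agreement would propagate by induction to all
    levels; so the predicate given to [epsilon] is inhabited. *)
Lemma Nmax_spec (d k : nat) (x y : ray d k) :
  ~ (forall i, choice x i = choice y i) ->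
  agree (Nmax x y) x y /\ ~ agree (S (Nmax x y)) x y.
Proof.
  intros Hne. unfold Nmax. apply epsilon_spec. apply NNPP. intros Hno. apply Hne.
  assert (Hall : forall n, agree n x y).
  { induction n as [|n IH]; [intros i Hi; lia|].
    apply NNPP. intros Hn. apply Hno. now exists n. }
  intros i. apply (Hall (S i)). lia.
Qed.

Lemma dist_pos_eq (d k : nat) (x y : ray d k) :
  0 < dist x y -> exists n, dist x y = / INR d ^ n.
Proof.
  unfold dist. destruct (excluded_middle_informative _); [lra|]. intros _.
  now exists (Nmax x y).
Qed.

Lemma agree_dist (d k : nat) (hd : (2 <= d)%nat) (n : nat) (x y : ray d k) :
  agree n x y <-> dist x y <= / INR d ^ n.
Proof.
  unfold dist. destruct (excluded_middle_informative _) as [He|Hne].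
  - split; [|now intros _ i _].
    intros _. left. apply Rinv_0_lt_compat, pow_INR_pos, hd.
  - destruct (Nmax_spec d k x y Hne) as [H1 H2]. rewrite inv_pow_INR_le by exact hd.
    split; intros H.
    + destruct (le_dec n (Nmax x y)) as [|Hn]; [assumption|exfalso].
      apply H2. apply agree_le with n; [lia|exact H].
    + now apply agree_le with (Nmax x y).
Qed.

Lemma dist_splitting (d k : nat) (hd : (2 <= d)%nat) (n : nat) (x y : ray d k) :
  agree n x y -> ~ agree (S n) x y -> dist x y = / INR d ^ n.
Proof.
  intros H1 H2.
  assert (Hpos : 0 < dist x y).
  { destruct (Rlt_le_dec 0 (dist x y)) as [|Hle]; [assumption|exfalso].
    apply H2. apply agree_dist; [exact hd|].
    pose proof (Rinv_0_lt_compat _ (pow_INR_pos d (S n) hd)). lra. }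
  destruct (dist_pos_eq d k x y Hpos) as [m Hm].
  rewrite agree_dist in H1, H2 by exact hd. rewrite Hm in *.
  rewrite inv_pow_INR_le in H1, H2 by exact hd.
  replace m with n by lia. reflexivity.
Qed.

Lemma cyl_is_ball (d k : nat) (hd : (2 <= d)%nat) (n : nat) (x : ray d k) :
  is_ball (cyl n x).
Proof.
  exists x, (/ INR d ^ n). split; [apply Rinv_0_lt_compat, pow_INR_pos, hd|].
  intros y. now apply agree_dist.
Qed.

(** Nonzero distances are powers of [1/d], so the radius can be rounded down to the largest such
    power, the one with least exponent. One level serves all [x] because every point of an
    ultrametric ball is a centre. *)
Lemma ball_is_cyl (d k : nat) (hd : (2 <= d)%nat) (B : rset d k) :
  is_ball B -> exists n, forall x, B x -> B = cyl n x.
Proof.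
  intros [c [r [Hr HB]]].
  assert (Hex : exists n, / INR d ^ n <= r /\
                  forall m, (m < n)%nat -> ~ / INR d ^ m <= r).
  { destruct (inv_pow_INR_small d r hd Hr) as [n Hn].
    destruct (dec_inh_nat_subset_has_unique_least_element
                (fun n => / INR d ^ n <= r)) as [m [[Hm Hmin] _]].
    - intros m. apply classic.
    - exists n. lra.
    - exists m. split; [exact Hm|]. intros j Hj Hjr. apply Hmin in Hjr. lia. }
  destruct Hex as [n [Hn Hmin]].
  assert (HBc : B = cyl n c).
  { apply rset_ext. intros y. rewrite HB. unfold cyl. split; intros Hy.
    - destruct (Rlt_le_dec 0 (dist c y)) as [Hpos|Hle].
      + destruct (dist_pos_eq d k c y Hpos) as [m Hm]. apply agree_dist; [exact hd|].
        rewrite Hm in *. apply inv_pow_INR_le; [exact hd|].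
        destruct (le_dec n m) as [|Hnm]; [assumption|exfalso].
        apply (Hmin m); [lia|exact Hy].
      + apply agree_dist; [exact hd|].
        pose proof (Rinv_0_lt_compat _ (pow_INR_pos d n hd)). lra.
    - apply agree_dist in Hy; [|exact hd]. lra. }
  exists n. intros x Hx. rewrite HBc in *. now apply cyl_center.
Qed.

(** * Images and homotheties *)

Lemma inverse_sym (d k : nat) (f f' : rmap d k) : inverse_of f f' -> inverse_of f' f.
Proof. intros [H1 H2]. now split. Qed.

Lemma inverse_unique (d k : nat) (f a b : rmap d k) :
  inverse_of f a -> inverse_of f b -> a = b.
Proof.
  intros [_ Ha] [Hb _]. apply functional_extensionality. intros x.
  rewrite <- (Hb x) at 1. apply Ha.
Qed.

Lemma inverse_compose (d k : nat) (a b a' b' : rmap d k) :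
  inverse_of a a' -> inverse_of b b' -> inverse_of (compose a b) (compose b' a').
Proof.
  intros [Ha Ha'] [Hb Hb']. unfold compose.
  split; intros x; [now rewrite Hb, Ha|now rewrite Ha', Hb'].
Qed.

Lemma image_compose (d k : nat) (a b : rmap d k) (B : rset d k) :
  image (compose a b) B = image a (image b B).
Proof.
  apply rset_ext. intros y. split.
  - intros [x [Hx ->]]. exists (b x). split; [now exists x|reflexivity].
  - intros [z [[x [Hx ->]] ->]]. now exists x.
Qed.

Lemma image_id (d k : nat) (B : rset d k) : image (fun x => x) B = B.
Proof.
  apply rset_ext. intros y. split; [now intros [x [Hx ->]]|intros H; now exists y].
Qed.

Lemma image_inverse (d k : nat) (f f' : rmap d k) (B : rset d k) :
  inverse_of f f' -> image f' (image f B) = B.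
Proof.
  intros [_ H]. rewrite <- image_compose. rewrite <- (image_id d k B) at 2.
  f_equal. apply functional_extensionality. intros x. apply H.
Qed.

Lemma homothety_on_subset (d k : nat) (f : rmap d k) (A B : rset d k) :
  (forall x, A x -> B x) -> homothety_on f B -> homothety_on f A.
Proof. intros H [lam [Hl Hf]]. exists lam. split; auto. Qed.

Lemma homothety_on_compose (d k : nat) (a b : rmap d k) (B : rset d k) :
  homothety_on b B -> homothety_on a (image b B) -> homothety_on (compose a b) B.
Proof.
  intros [l [Hl Hb]] [m [Hm Ha]]. exists (m * l). split; [nra|].
  intros x y Hx Hy. unfold compose. rewrite Ha by (eexists; eauto).
  rewrite Hb by assumption. ring.
Qed.

Lemma homothety_on_inverse (d k : nat) (f f' : rmap d k) (B : rset d k) :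
  inverse_of f f' -> homothety_on f B -> homothety_on f' (image f B).
Proof.
  intros [_ Hi] [l [Hl Hf]]. exists (/ l). split; [now apply Rinv_0_lt_compat|].
  intros ? ? [x [Hx ->]] [y [Hy ->]]. rewrite !Hi, Hf by assumption. field. lra.
Qed.

Lemma homothety_on_id (d k : nat) (B : rset d k) : homothety_on (fun x => x) B.
Proof. exists 1. split; [lra|intros; ring]. Qed.

(** Two rays splitting at level [p] are at distance exactly [d^(-p)], and their images at some
    distance [d^(-q)]. Hence the ratio is [d^(p-q)], and the homothety shifts all levels by
    [q - p]. *)
Lemma homothety_shifts_levels (d k : nat) (hd : (2 <= d)%nat) (hk : (2 <= k)%nat)
  (h : rmap d k) (p : nat) (x : ray d k) :
  homothety_on h (cyl p x) ->
  exists q, forall y z j, cyl p x y -> cyl p x z ->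
    (agree (p + j) y z <-> agree (q + j) (h y) (h z)).
Proof.
  intros [lam [Hl Hh]].
  destruct (ray_splitting_off d k hd hk x p) as [y0 [H1 H2]].
  pose proof (dist_splitting d k hd p x y0 H1 H2) as Hd0.
  pose proof (Hh x y0 (agree_refl d k p x) H1) as Hd1. rewrite Hd0 in Hd1.
  pose proof (pow_INR_pos d p hd) as Hp.
  destruct (dist_pos_eq d k (h x) (h y0)) as [q Hq].
  { rewrite Hd1. apply Rmult_lt_0_compat; [exact Hl|now apply Rinv_0_lt_compat]. }
  exists q. intros y z j Hy Hz. rewrite !agree_dist by exact hd.
  rewrite (Hh y z Hy Hz), !pow_add, !Rinv_mult, <- Hq, Hd1.
  rewrite Rmult_assoc. split; intros H.
  - apply Rmult_le_compat_l; [lra|exact H].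
  - now apply Rmult_le_reg_l with lam.
Qed.

Lemma continuous_agree (d k : nat) (hd : (2 <= d)%nat) (f : rmap d k) (z : ray d k) (n : nat) :
  continuous_map f -> exists m, forall y, agree m z y -> agree n (f z) (f y).
Proof.
  intros Hf.
  destruct (Hf z (/ INR d ^ n)) as [del [Hdel H]];
    [apply Rinv_0_lt_compat, pow_INR_pos, hd|].
  destruct (inv_pow_INR_small d del hd Hdel) as [m Hm]. exists m. intros y Hy.
  apply agree_dist; [exact hd|]. left. apply H.
  apply agree_dist in Hy; [lra|exact hd].
Qed.

(* The image is dense in the target cylinder because at each level [>= 1] both
   sides have exactly [d] children; at level [0] this fails when [k > d]. *)
Lemma level_shift_image (d k : nat) (hd : (2 <= d)%nat) (h : rmap d k)
  (n m : nat) (x : ray d k) :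
  homeomorphism h -> (1 <= n)%nat -> (1 <= m)%nat ->
  (forall y z j, cyl n x y -> cyl n x z ->
    (agree (n + j) y z <-> agree (m + j) (h y) (h z))) ->
  image h (cyl n x) = cyl m (h x).
Proof.
  intros [_ [h' [[Hi Hi'] Hc]]] Hn Hm Hs. apply rset_ext. intros z. split.
  - intros [y [Hy ->]]. unfold cyl. rewrite <- (Nat.add_0_r m).
    apply Hs; [apply agree_refl|exact Hy|]. now rewrite Nat.add_0_r.
  - intros Hz.
    (* Approximate preimages of [z] are built level by level. The rays [u i] pass through the [d]
       children of the vertex of [y] at level [n + j]; their images pass through distinct children
       of the image vertex, hence through all [d] of them, in particular the one on [z]. *)
    assert (Hdense : forall j, exists y, cyl n x y /\ agree (m + j) z (h y)).
    { induction j as [|j [y [Hy Hzy]]].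
      - exists x. split; [apply agree_refl|]. rewrite Nat.add_0_r. apply agree_sym, Hz.
      - assert (Hch : forall i, exists u, (i < d)%nat ->
                   agree (n + j) y u /\ choice u (n + j) = i).
        { intros i. destruct (le_dec d i) as [Hle|Hlt]; [exists x; lia|].
          destruct (ray_with_choice d k y (n + j) i) as [u Hu].
          - destruct (n + j)%nat eqn:E; lia.
          - now exists u. }
        set (u := fun i => proj1_sig (constructive_indefinite_description _ (Hch i))).
        assert (Hu : forall i, (i < d)%nat -> agree (n + j) y (u i) /\ choice (u i) (n + j) = i).
        { intros i. exact (proj2_sig (constructive_indefinite_description _ (Hch i))). }
        assert (Hux : forall i, (i < d)%nat -> cyl n x (u i)).
        { intros i Hid. apply agree_trans with y; [exact Hy|].
          apply agree_le with (n + j)%nat; [lia|]. now apply Hu. }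
        set (f := fun i => choice (h (u i)) (m + j)).
        assert (Hsurj : bSurjective d f).
        { apply bInjective_bSurjective.
          - intros i Hid. unfold f. pose proof (proj2_sig (h (u i)) (m + j)%nat) as Hb.
            unfold choice. destruct (m + j)%nat eqn:E; [lia|exact Hb].
          - intros i i' Hid Hid' Hff.
            assert (Hag : agree (m + S j) (h (u i)) (h (u i'))).
            { rewrite Nat.add_succ_r. apply agree_S. split; [|exact Hff].
              apply Hs; [now apply Hux|now apply Hux|].
              apply agree_trans with y; [apply agree_sym|]; now apply Hu. }
            apply Hs in Hag; [|now apply Hux|now apply Hux].
            rewrite Nat.add_succ_r in Hag. apply agree_S in Hag as [_ Hag].
            now rewrite (proj2 (Hu i Hid)), (proj2 (Hu i' Hid')) in Hag. }
        destruct (Hsurj (choice z (m + j))) as [i [Hid Hfi]].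
        { pose proof (proj2_sig z (m + j)%nat) as Hb. unfold choice.
          destruct (m + j)%nat eqn:E; [lia|exact Hb]. }
        exists (u i). split; [now apply Hux|]. rewrite Nat.add_succ_r. apply agree_S.
        split; [|symmetry; exact Hfi]. apply agree_trans with (h y); [exact Hzy|].
        apply Hs; [exact Hy|now apply Hux|]. now apply Hu. }
    (* Continuity of [h'] at [z] makes [h' z] agree to level [n] with a good enough approximation
       [y], which lies in the cylinder. *)
    exists (h' z). split; [|symmetry; apply Hi].
    destruct (continuous_agree d k hd h' z n Hc) as [j Hj].
    destruct (Hdense j) as [y [Hy Hzy]].
    apply agree_trans with y; [exact Hy|]. rewrite <- (Hi' y). apply agree_sym, Hj.
    apply agree_le with (m + j)%nat; [lia|exact Hzy].
Qed.

(** Passing to a strictly smaller ball, [p < n], keeps both the level [n] and the image level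
    [q + (n - p)] away from the root, where the number of children may differ. *)
Lemma homothety_image_cyl (d k : nat) (hd : (2 <= d)%nat) (hk : (2 <= k)%nat)
  (h : rmap d k) (p n : nat) (x : ray d k) :
  homeomorphism h -> homothety_on h (cyl p x) -> (p < n)%nat ->
  homothety_on h (cyl n x) /\ exists m, image h (cyl n x) = cyl m (h x).
Proof.
  intros Hh Hhom Hpn.
  assert (Hsub : forall y, cyl n x y -> cyl p x y).
  { intros y. apply cyl_le. lia. }
  split; [now apply homothety_on_subset with (cyl p x)|].
  destruct (homothety_shifts_levels d k hd hk h p x Hhom) as [q Hq].
  exists (q + (n - p))%nat. apply level_shift_image; try assumption; try lia.
  intros y z j Hy Hz. specialize (Hq y z (n - p + j)%nat (Hsub y Hy) (Hsub z Hz)).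
  replace (p + (n - p + j))%nat with (n + j)%nat in Hq by lia.
  now rewrite Nat.add_assoc in Hq.
Qed.

(** * Maps acting homothetically on all balls of large level *)

(** [homothety_on] only scales distances, so that the image is again a ball is recorded separately;
    the level [m] of the image is left free. *)
Definition homothetic_from {d k : nat} (L : nat) (h : rmap d k) : Prop :=
  forall n x, (L <= n)%nat ->
    homothety_on h (cyl n x) /\ exists m, image h (cyl n x) = cyl m (h x).

Lemma homothetic_from_le (d k L L' : nat) (h : rmap d k) :
  (L <= L')%nat -> homothetic_from L h -> homothetic_from L' h.
Proof. intros HL H n x Hn. apply H. lia. Qed.

(** The finitely many parts each have a level, and [L] bounds all of them. Balls of level at least
    [L] thus lie inside parts of [P]. *)
Lemma regular_level_bound (d k : nat) (hd : (2 <= d)%nat) (P : rpartition d k) :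
  regular P -> exists L, forall x, exists p, (p <= L)%nat /\ P (cyl p x).
Proof.
  intros [[l Hl] [Hball [Hcov _]]].
  destruct (list_uniform_bound _ (fun (B : rset d k) n => forall x, B x -> B = cyl n x) l)
    as [L HL].
  - intros B HB. apply ball_is_cyl; [exact hd|]. now apply Hball, Hl.
  - exists L. intros x. destruct (Hcov x) as [B [HB HBx]].
    destruct (HL B) as [p [Hp Hc]]; [now apply Hl|].
    exists p. split; [exact Hp|]. now rewrite <- (Hc x HBx).
Qed.

(** From level [S L] on, a ball is indexed strictly deeper than the part around it, as
    [homothety_image_cyl] requires. *)
Lemma admissible_homothetic_from (d k : nat) (hd : (2 <= d)%nat) (hk : (2 <= k)%nat)
  (P : rpartition d k) (L : nat) (h : rmap d k) :
  (forall x, exists p, (p <= L)%nat /\ P (cyl p x)) ->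
  homeomorphism h -> admissible P h -> homothetic_from (S L) h.
Proof.
  intros HL Hh Ha n x Hn. destruct (HL x) as [p [Hp HP]].
  apply homothety_image_cyl with p; try assumption; [now apply Ha|lia].
Qed.

Lemma homeomorphism_inverse (d k : nat) (h h' : rmap d k) :
  homeomorphism h -> inverse_of h h' -> homeomorphism h'.
Proof.
  intros [Hc [h'' [Hi Hc']]] Hh. rewrite (inverse_unique d k h h' h'' Hh Hi) in *.
  split; [exact Hc'|]. exists h. split; [now apply inverse_sym|exact Hc].
Qed.

(** The images under [h] of the finitely many balls of level [L] are balls of level at most some
    [M]; they cover the boundary, and [h'] is homothetic on each. Balls of level above [M] lie
    inside them. *)
Lemma homothetic_from_inverse (d k : nat) (hd : (2 <= d)%nat) (hk : (2 <= k)%nat)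
  (L : nat) (h h' : rmap d k) :
  homeomorphism h -> inverse_of h h' -> homothetic_from L h ->
  exists L', homothetic_from L' h'.
Proof.
  intros Hh Hi HL. destruct (cyls_of_level d k L) as [l Hl].
  destruct (list_uniform_bound _
    (fun (B : rset d k) m => forall x, B = cyl L x -> image h B = cyl m (h x)) l)
    as [M HM].
  { intros B _. destruct (classic (exists x, B = cyl L x)) as [[x ->]|Hno].
    - destruct (HL L x (le_n L)) as [_ [m Hm]]. exists m. intros y Hy.
      rewrite Hm. apply cyl_center. rewrite <- Hm. exists y. split; [|reflexivity].
      rewrite Hy. apply agree_refl.
    (* Members of [l] that are not balls of level [L] satisfy the condition vacuously; 0 is a dummy
       value. *)
    - exists 0%nat. intros x Hx. exfalso. apply Hno. now exists x. }
  exists (S M). intros n z Hn.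
  destruct (HM (cyl L (h' z)) (Hl _)) as [m [Hm Himg]].
  specialize (Himg (h' z) eq_refl). destruct Hi as [Hi Hi']. rewrite Hi in Himg.
  apply homothety_image_cyl with m; try assumption; [| |lia].
  - apply homeomorphism_inverse with h; [exact Hh|now split].
  - rewrite <- Himg. apply homothety_on_inverse; [now split|]. apply HL. lia.
Qed.

(** * The partition into maximal good balls *)

Definition map_group {d k : nat} (G : rmap d k -> Prop) : Prop :=
  G (fun x => x) /\ (forall a b, G a -> G b -> G (compose a b)) /\
  forall a, G a -> exists a', inverse_of a a' /\ G a'.

(** The lower bound concerns every translate of [B], so goodness is invariant under [G]. Applied to
    the identity it bounds the level of [B] itself, which makes the parts proper and, for large [L],
    contained in parts of [P]. *)
Definition good {d k : nat} (G : rmap d k -> Prop) (L : nat) (B : rset d k) : Prop :=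
  forall h, G h -> homothety_on h B /\ exists m c, (L <= m)%nat /\ image h B = cyl m c.

Definition max_good {d k : nat} (G : rmap d k -> Prop) (L : nat) (B : rset d k) : Prop :=
  good G L B /\ forall C, good G L C -> (forall x, B x -> C x) -> C = B.

Lemma good_cyl (d k : nat) (G : rmap d k -> Prop) (L : nat) (B : rset d k) :
  map_group G -> good G L B -> exists m c, (L <= m)%nat /\ B = cyl m c.
Proof.
  intros [Hid _] HB. destruct (HB _ Hid) as [_ [m [c [Hm Hc]]]].
  rewrite image_id in Hc. now exists m, c.
Qed.

(** On [image h B] an element [a] factors as [h'] followed by [compose a h], and both are homothetic
    there because [B] is good. *)
Lemma good_image (d k : nat) (G : rmap d k -> Prop) (L : nat) (B : rset d k) (h : rmap d k) :
  map_group G -> G h -> good G L B -> good G L (image h B).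
Proof.
  intros [_ [Hcomp Hinv]] Hh HB a Ha.
  destruct (Hinv h Hh) as [h' [Hi Hh']]. split.
  - replace a with (compose (compose a h) h').
    + apply homothety_on_compose.
      * apply homothety_on_inverse; [exact Hi|]. now apply HB.
      * rewrite (image_inverse d k h h' B Hi). apply HB. auto.
    + apply functional_extensionality. intros x. unfold compose. now rewrite (proj1 Hi).
  - rewrite <- image_compose. apply HB. auto.
Qed.

(** [G] permutes the good balls and preserves inclusion: a good ball containing the image is pulled
    back by [h'] to a good ball containing [B]. *)
Lemma max_good_image (d k : nat) (G : rmap d k -> Prop) (L : nat) (B : rset d k)
  (h : rmap d k) : map_group G -> G h -> max_good G L B -> max_good G L (image h B).
Proof.
  intros HG Hh [HB Hmax]. split; [now apply good_image|].
  intros C HC Hsub. destruct (proj2 (proj2 HG) h Hh) as [h' [Hi Hh']].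
  rewrite <- (Hmax (image h' C)).
  - symmetry. apply image_inverse. now apply inverse_sym.
  - now apply good_image.
  - intros x Hx. exists (h x). split; [|symmetry; apply Hi].
    apply Hsub. now exists x.
Qed.

(** Take the least level at which the ball around [x] is good. A good ball containing this one is
    also centred at [x], so its level cannot be smaller. *)
Lemma max_good_cover (d k : nat) (G : rmap d k -> Prop) (L N : nat) (x : ray d k) :
  map_group G -> (exists n, (n <= N)%nat /\ good G L (cyl n x)) ->
  exists n, (n <= N)%nat /\ max_good G L (cyl n x).
Proof.
  intros HG [n0 [Hn0 Hgood]].
  destruct (dec_inh_nat_subset_has_unique_least_element
              (fun n => good G L (cyl n x))) as [n [[Hn Hmin] _]].
  - intros m. apply classic.
  - now exists n0.
  - exists n. split; [specialize (Hmin n0 Hgood); lia|]. split; [exact Hn|].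
    intros C HC Hsub. destruct (good_cyl d k G L C HG HC) as [m [c [_ ->]]].
    pose proof (Hsub x (agree_refl d k n x)) as Hcx.
    rewrite (cyl_center d k m c x Hcx) in *.
    apply rset_ext. intros y. split; [|apply Hsub].
    apply cyl_le. now apply Hmin.
Qed.

(** Intersecting ultrametric balls are nested, so maximality of the smaller one forces equality. *)
Lemma max_good_disjoint (d k : nat) (G : rmap d k -> Prop) (L : nat) (A B : rset d k)
  (x : ray d k) :
  map_group G -> max_good G L A -> max_good G L B -> A x -> B x -> A = B.
Proof.
  intros HG [HA HmA] [HB HmB] Hx Hx'.
  destruct (good_cyl d k G L A HG HA) as [m [c [_ Ec]]].
  destruct (good_cyl d k G L B HG HB) as [n [c' [_ Ec']]].
  rewrite Ec in Hx. rewrite Ec' in Hx'.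
  rewrite (cyl_center d k _ _ _ Hx) in Ec. rewrite (cyl_center d k _ _ _ Hx') in Ec'.
  destruct (Nat.le_ge_cases m n) as [Hmn|Hmn].
  - apply HmB; [exact HA|]. rewrite Ec, Ec'. intros y. now apply cyl_le.
  - symmetry. apply HmA; [exact HB|]. rewrite Ec, Ec'. intros y. now apply cyl_le.
Qed.

Lemma max_good_regular (d k : nat) (hd : (2 <= d)%nat) (hk : (2 <= k)%nat)
  (G : rmap d k -> Prop) (L N : nat) :
  map_group G -> (1 <= L)%nat ->
  (forall x, exists n, (n <= N)%nat /\ good G L (cyl n x)) ->
  regular (max_good G L).
Proof.
  intros HG HL Hcov. repeat split.
  (* Finiteness: a maximal good ball meets, hence equals, one of level at most [N]. *)
  - destruct (cyls_below_level d k (S N)) as [l Hl]. apply (list_restrict _ _ l).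
    intros B HB. destruct (good_cyl d k G L B HG (proj1 HB)) as [m [c [_ Ec]]].
    destruct (max_good_cover d k G L N c HG (Hcov c)) as [n [Hn Hmax]].
    rewrite (max_good_disjoint d k G L B (cyl n c) c); auto.
    + apply Hl. lia.
    + rewrite Ec. apply agree_refl.
    + apply agree_refl.
  - destruct (good_cyl d k G L B HG (proj1 H)) as [m [c [_ ->]]].
    now apply cyl_is_ball.
  - destruct (good_cyl d k G L B HG (proj1 H)) as [m [c [Hm ->]]].
    (* A ray leaving [c] already at the root avoids the ball, whose level is at least [L >= 1]. *)
    destruct (ray_splitting_off d k hd hk c 0) as [y [_ Hy]].
    exists y. intros Hcy. apply Hy. apply agree_le with m; [lia|exact Hcy].
  - intros x. destruct (max_good_cover d k G L N x HG (Hcov x)) as [n [_ Hn]].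
    exists (cyl n x). split; [exact Hn|apply agree_refl].
  - intros A B x HA HB. now apply (max_good_disjoint d k G L).
Qed.

Lemma locally_homothetic_continuous (d k : nat) (hd : (2 <= d)%nat) (h : rmap d k) :
  (forall x, exists n, homothety_on h (cyl n x)) -> continuous_map h.
Proof.
  intros H x eps Heps. destruct (H x) as [n [lam [Hl Hh]]].
  pose proof (Rinv_0_lt_compat _ (pow_INR_pos d n hd)) as Hpos.
  exists (Rmin (/ INR d ^ n) (eps / lam)). split.
  - apply Rmin_glb_lt; [exact Hpos|]. now apply Rdiv_lt_0_compat.
  - intros y Hy. rewrite Hh; [|apply agree_refl|].
    + apply Rlt_le_trans with (lam * (eps / lam)); [|right; field; lra].
      apply Rmult_lt_compat_l; [exact Hl|].
      apply Rlt_le_trans with (1 := Hy). apply Rmin_r.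
    + apply agree_dist; [exact hd|]. left.
      apply Rlt_le_trans with (1 := Hy). apply Rmin_l.
Qed.

(** Continuity of [h] and of its inverse in [G] comes from their being homothetic on the good balls,
    which cover the boundary; invariance of the partition is [max_good_image] for [h] and for its
    inverse. *)
Lemma max_good_stab (d k : nat) (hd : (2 <= d)%nat) (hk : (2 <= k)%nat)
  (G : rmap d k -> Prop) (L N : nat) :
  map_group G -> (1 <= L)%nat ->
  (forall x, exists n, (n <= N)%nat /\ good G L (cyl n x)) ->
  forall h, G h -> Stab (max_good G L) h.
Proof.
  intros HG HL Hcov h Hh.
  assert (Hcont : forall a, G a -> continuous_map a).
  { intros a Ha. apply locally_homothetic_continuous; [exact hd|]. intros x.
    destruct (Hcov x) as [n [_ Hn]]. exists n. now apply Hn. }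
  assert (Hadm : admissible (max_good G L) h).
  { intros B [HB _]. now apply HB. }
  destruct (proj2 (proj2 HG) h Hh) as [h' [Hi Hh']].
  split; [split|split; [exact Hadm|split]].
  - split; [now apply Hcont|]. exists h'. split; [exact Hi|now apply Hcont].
  - exists (max_good G L). split; [|exact Hadm]. now apply max_good_regular with N.
  - intros B HB. now apply max_good_image.
  - intros B HB. exists (image h' B). split; [now apply max_good_image|].
    symmetry. apply image_inverse. now apply inverse_sym.
Qed.

(** * Translations and shallow balls *)

Lemma homothety_into_itself_translation (d k : nat) (hd : (2 <= d)%nat) (hk : (2 <= k)%nat)
  (h h' : rmap d k) (m n : nat) (x : ray d k) :
  inverse_of h h' -> (m < n)%nat -> homothety_on h (cyl m x) ->
  image h (cyl m x) = cyl n x -> translation h.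
Proof.
  intros Hi Hmn Hhom Himg. exists h'. split; [exact Hi|].
  exists (cyl m x), 1%Z. change (zpow h h' 1) with h. rewrite Himg.
  split; [now apply cyl_is_ball|]. split; [exact Hhom|]. split.
  - intros y. apply cyl_le. lia.
  - destruct (ray_splitting_off d k hd hk x m) as [y [H1 H2]].
    exists y. split; [exact H1|]. intros H. apply H2. now apply agree_le with n.
Qed.

(** This is not literally the negation of [good]: on a ball that is not shallow, an element could
    still fail to be homothetic. [not_shallow_good] excludes this for the generated group. *)
Definition shallow {d k : nat} (G : rmap d k -> Prop) (L : nat) (B : rset d k) : Prop :=
  exists w m c, G w /\ homothety_on w B /\ (m < L)%nat /\ image w B = cyl m c.

Lemma not_shallow_of_no_translation (d k : nat) (hd : (2 <= d)%nat) (hk : (2 <= k)%nat)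
  (G : rmap d k -> Prop) (L : nat) :
  map_group G -> (forall h, G h -> ~ translation h) ->
  exists N, forall x, exists n, (n <= N)%nat /\ ~ shallow G L (cyl n x).
Proof.
  intros [_ [Hcomp Hinv]] Hnt. destruct (cyls_below_level d k L) as [l Hl].
  exists (length l). intros x. apply NNPP. intros Hno.
  destruct (pigeonhole_rel _
    (fun n B => exists w, G w /\ homothety_on w (cyl n x) /\ image w (cyl n x) = B) l)
    as [i [j [B [Hij [[a [Ga [Ha Ia]]] [b [Gb [Hb Ib]]]]]]]].
  - intros n Hn. apply NNPP. intros Hn'. apply Hno. exists n. split; [exact Hn|].
    intros [w [m [c [Gw [Hw [Hm Himg]]]]]]. apply Hn'.
    exists (cyl m c). split; [now apply Hl|]. now exists w.
  - destruct (Hinv a Ga) as [a' [Hia Ga']]. destruct (Hinv b Gb) as [b' [Hib Gb']].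
    (* Both [a] on level [i] and [b] on level [j] have image [B], so [compose b' a] maps the ball of
       level [i] onto the one of level [j > i]. *)
    apply (Hnt (compose b' a)); [now apply Hcomp|].
    apply homothety_into_itself_translation with (compose a' b) i j x; try assumption.
    + apply inverse_compose; [now apply inverse_sym|exact Hia].
    + lia.
    + apply homothety_on_compose; [exact Ha|]. rewrite Ia, <- Ib.
      now apply homothety_on_inverse.
    + rewrite image_compose, Ia, <- Ib. now apply image_inverse.
Qed.

(** * The group generated by [K] and [g] *)

(** The constructor [gen_inv] only admits a map already known to be an inverse; that each word has
    an inverse is shown by induction. *)
Lemma gen_map_group (d k : nat) (K : rmap d k -> Prop) (g : rmap d k) :
  subgroup K -> homeomorphism g -> map_group (gen K g).
Proof.
  intros [HKa _] [_ [g' [Hg _]]].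
  split; [apply gen_id|split; [apply gen_comp|]].
  assert (H : forall a, gen K g a -> exists a', inverse_of a a').
  { induction 1 as [h Hh| | |a b _ [a' Ha] _ [b' Hb]|a b _ _ Hab].
    - destruct (HKa h Hh) as [[_ [h' [Hi _]]] _]. now exists h'.
    - now exists g'.
    - exists (fun x => x). now split.
    - exists (compose b' a'). now apply inverse_compose.
    - exists a. now apply inverse_sym. }
  intros a Ha. destruct (H a Ha) as [a' Hi]. exists a'. split; [exact Hi|].
  now apply gen_inv with a.
Qed.

Lemma not_shallow_good (d k : nat) (K : rmap d k -> Prop) (g : rmap d k) (L n : nat)
  (x : ray d k) :
  subgroup K -> homeomorphism g ->
  (forall h, K h -> homothetic_from L h) -> homothetic_from L g ->
  (forall g', inverse_of g g' -> homothetic_from L g') ->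
  ~ shallow (gen K g) L (cyl n x) -> good (gen K g) L (cyl n x).
Proof.
  intros HK Hg HKL HgL HgL' Hns.
  (* The balls reached from the given one by elements homothetic on it. As that ball is not shallow,
     all of them have level at least [L], where the generators and their inverses are homothetic; so
     these never leave [orb]. *)
  set (orb := fun C : rset d k => (exists m c, C = cyl m c) /\
         exists w, gen K g w /\ homothety_on w (cyl n x) /\ image w (cyl n x) = C).
  assert (Hdeep : forall C, orb C -> exists m c, (L <= m)%nat /\ C = cyl m c).
  { intros C [[m [c Hc]] [w [Gw [Hw Iw]]]]. exists m, c. split; [|exact Hc].
    destruct (le_dec L m) as [|Hm]; [assumption|exfalso].
    apply Hns. exists w, m, c. repeat split; [exact Gw|exact Hw|lia|congruence]. }
  set (stable := fun h : rmap d k =>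
         forall C, orb C -> homothety_on h C /\ orb (image h C)).
  assert (Hgen : forall h, gen K g h -> homothetic_from L h -> stable h).
  { intros h Gh HL C HC. destruct (Hdeep C HC) as [m [c [Hm Ec]]].
    destruct (HL m c Hm) as [Hhom [q Hq]]. rewrite <- Ec in Hhom, Hq.
    split; [exact Hhom|]. split; [now exists q, (h c)|].
    destruct HC as [_ [w [Gw [Hw Iw]]]]. exists (compose h w).
    split; [now apply gen_comp|]. rewrite image_compose, Iw. split; [|reflexivity].
    apply homothety_on_compose; [exact Hw|now rewrite Iw]. }
  assert (Hcomp : forall a b, stable a -> stable b -> stable (compose a b)).
  { intros a b Ha Hb C HC. destruct (Hb C HC) as [Hb1 Hb2].
    destruct (Ha _ Hb2) as [Ha1 Ha2]. rewrite image_compose. split; [|exact Ha2].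
    now apply homothety_on_compose. }
  assert (Hid : stable (fun y => y)).
  { intros C HC. rewrite image_id. split; [apply homothety_on_id|exact HC]. }
  (* Stability of the inverse is carried through the induction because [gen_inv] inverts arbitrary
     words, not just generators. *)
  assert (Hall : forall h, gen K g h ->
            stable h /\ forall h', inverse_of h h' -> stable h').
  { induction 1 as [h Hh| | |a b Ga [Ha Ha'] Gb [Hb Hb']|a b Ga [Ha Ha'] Hab].
    - split; [apply Hgen; [now apply gen_K|now apply HKL]|]. intros h' Hi.
      assert (K h') by (apply (proj2 (proj2 (proj2 HK)) h h'); assumption).
      apply Hgen; [now apply gen_K|now apply HKL].
    - split; [apply Hgen; [apply gen_g|exact HgL]|]. intros g' Hi.
      apply Hgen; [apply gen_inv with g; [apply gen_g|exact Hi]|now apply HgL'].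
    - split; [exact Hid|]. intros h' Hi.
      now rewrite (inverse_unique d k _ h' (fun y => y) Hi).
    - split; [now apply Hcomp|]. intros h' Hi.
      destruct (proj2 (proj2 (gen_map_group d k K g HK Hg)) a Ga) as [a' [Hia _]].
      destruct (proj2 (proj2 (gen_map_group d k K g HK Hg)) b Gb) as [b' [Hib _]].
      rewrite (inverse_unique d k _ h' _ Hi (inverse_compose d k a b a' b' Hia Hib)).
      apply Hcomp; auto.
    - split; [now apply Ha'|]. intros h' Hi.
      now rewrite (inverse_unique d k b h' a Hi (inverse_sym d k a b Hab)). }
  (* The initial ball belongs to [orb] through the identity. *)
  intros h Gh. destruct (proj1 (Hall h Gh) (cyl n x)) as [Hhom Horb].
  - split; [now exists n, x|]. exists (fun y => y).
    split; [apply gen_id|]. split; [apply homothety_on_id|apply image_id].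
  - split; [exact Hhom|]. now apply Hdeep.
Qed.

Theorem mainTheorem12 (d k : nat) (hd : (2 <= d)%nat) (hk : (2 <= k)%nat)
  (g : rmap d k) (K : rmap d k -> Prop) (P : rpartition d k) :
  aaut g -> subgroup K -> rel_compact K ->
  regular P -> admissible P g -> (forall h, K h -> admissible P h) ->
  (forall h, gen K g h -> ~ translation h) ->
  exists Q : rpartition d k, regular Q /\ refines Q P /\
    (forall h, gen K g h -> Stab Q h).
Proof.
  intros [Hg _] HK _ HP HPg HPK Hnt.
  destruct (regular_level_bound d k hd P HP) as [L0 HL0].
  pose proof (admissible_homothetic_from d k hd hk P L0 g HL0 Hg HPg) as HgL.
  (* [P] is admissible for [g] but perhaps not for its inverse, which gets its own level; inverses
     of elements of [K] lie in [K] and are covered by [L0]. *)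
  assert (Hg' : exists L1, forall g', inverse_of g g' -> homothetic_from L1 g').
  { destruct Hg as [Hc [g' [Hi Hc']]].
    destruct (homothetic_from_inverse d k hd hk (S L0) g g') as [L1 HL1];
      [split; [exact Hc|now exists g']|exact Hi|exact HgL|].
    exists L1. intros g'' Hi'. now rewrite (inverse_unique d k g g'' g' Hi' Hi). }
  destruct Hg' as [L1 HL1].
  set (L := Nat.max (S L0) L1).
  pose proof (gen_map_group d k K g HK Hg) as HG.
  destruct (not_shallow_of_no_translation d k hd hk (gen K g) L HG Hnt) as [N HN].
  assert (Hcov : forall x, exists n, (n <= N)%nat /\ good (gen K g) L (cyl n x)).
  { intros x. destruct (HN x) as [n [Hn Hns]]. exists n. split; [exact Hn|].
    apply not_shallow_good; try assumption.
    - intros h Hh. apply homothetic_from_le with (S L0); [unfold L; lia|].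
      apply admissible_homothetic_from with P; try assumption; [|now apply HPK].
      apply (proj1 HK h Hh).
    - apply homothetic_from_le with (S L0); [unfold L; lia|exact HgL].
    - intros g' Hi. apply homothetic_from_le with L1; [unfold L; lia|now apply HL1]. }
  exists (max_good (gen K g) L). split; [|split].
  - apply max_good_regular with N; try assumption. unfold L. lia.
  - intros B [HB _]. destruct (good_cyl d k _ L B HG HB) as [m [c [Hm ->]]].
    (* The part of [P] around [c] has level [p <= L0 < L <= m], so it contains the ball of level
       [m]. *)
    destruct (HL0 c) as [p [Hp HPc]]. exists (cyl p c). split; [exact HPc|].
    intros y. apply cyl_le. unfold L in Hm. lia.
  - apply max_good_stab with N; try assumption. unfold L. lia.
Qed.
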